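(* Let $f:\mathbb{R}^3\to\mathbb{R}$ be a lower semicontinuous function. Let $C_f$ be the set of $x\in\mathbb{R}^3$ for which $Df(x)=0$ and $\partial^3 f(x)$ is nonempty. Then $\mathcal{L}^1\bigl(f(C_f)\bigr)=0$.
   Context: $\mathcal{L}^1$ denotes Lebesgue outer measure on $\mathbb{R}$. A function $f:\mathbb{R}^3\to\mathbb{R}$ has a Taylor expansion of order $2$ at $x$ if there exist $k$-homogeneous polynomials $P_x^k$ on $\mathbb{R}^3$, $k=1,2$, such that $$\lim_{h\to 0}\frac{f(x+h)-f(x)-P_x^1(h)-P_x^2(h)}{|h|^{2}}=0.$$ Such polynomials are unique when they exist; in that case $f$ is differentiable at $x$ with $Df(x)=P_x^1$. If $f$ has a Taylor expansion of order $2$ at $x$, then $\partial^3 f(x)$ is the set of all $3$-homogeneous polynomials $Q$ on $\mathbb{R}^3$ such that $$\liminf_{h\to 0}\frac{f(x+h)-f(x)-Df(x)(h)-P_x^2(h)-Q(h)}{|h|^3}\geq 0.$$ If $f$ has no Taylor expansion of order $2$ at $x$, then $\partial^3 f(x)=\emptyset$. *)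

(* Defs.v *)
From mathcomp Require Import all_boot all_order all_algebra.
From mathcomp Require Import all_classical all_reals all_analysis.
(* Some notations of mpoly clash with those of analysis; the rest of mpoly
   (in particular its structure instances) is imported. *)
From mathcomp Require mpoly.
Import -(notations) mpoly.

Set Implicit Arguments.
Unset Strict Implicit.
Unset Printing Implicit Defensive.

Import Order.TTheory GRing.Theory Num.Theory.
Import numFieldNormedType.Exports.

Local Open Scope classical_set_scope.
Local Open Scope ring_scope.

Section ThirdOrderSubjet.
Variable R : realType.
Implicit Types (f : 'rV[R]_3 -> R) (x h : 'rV[R]_3).

Definition poly3 := mpoly 3 R.

Implicit Types P Q : poly3.

(* As in mpoly, the zero polynomial is k-homogeneous for every k. *)
Definition homogeneous (k : nat) P : Prop :=
  P \is ishomog1 k (@mdeg 3).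

Definition evalp P h : R := meval (fun i => h ord0 i) P.

(* The library norm `|h| on 'rV[R]_3 is the sup norm. *)
Definition enorm h : R := Num.sqrt (\sum_(i < 3) h ord0 i ^+ 2).

Definition taylor2 f x P1 P2 : Prop :=
  [/\ homogeneous 1 P1, homogeneous 2 P2 &
      (f (x + h) - f x - evalp P1 h - evalp P2 h) / enorm h ^+ 2
        @[h --> (0 : 'rV[R]_3)^'] --> (0 : R)].

(* The set is empty when f has no expansion of order 2 at x; when there is
   one, (P1, P2) is unique and f is differentiable at x. *)
Definition subdiff3 f x : set poly3 :=
  [set Q | homogeneous 3 Q /\
     exists P1 P2, taylor2 f x P1 P2 /\
       (0 <= limf_einf
          (fun h => ((f (x + h) - f x - 'd f x h - evalp P2 h - evalp Q h)
                       / enorm h ^+ 3)%:E)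
          (0%R : 'rV[R]_3)^')%E].

Definition crit3 f : set 'rV[R]_3 :=
  [set x | [/\ differentiable f x,
               'd f x = cst 0 :> ('rV[R]_3 -> R) &
               subdiff3 f x !=set0]].

(* Infimum of the total lengths of countable covers by intervals ]a, b],
   defined on all subsets of R; lebesgue_measure unfolds to it. *)
Definition lebesgue_outer : set R -> \bar R :=
  mu_ext (@wlength R idfun).

End ThirdOrderSubjet.

(* Main.v *)
(* The critical set is cut into countably many pieces A on which f satisfies
   |f x - f y| <= C |p x - p y|^m with m >= 2, where p selects m coordinates;
   such a piece has a null image. Indeed, let K be the best constant with
   mu(f(A `&` p^-1 Q)) <= K r^m for all cubes Q of side r, and divide Q into N^m
   subcubes. If a subcube misses A, the bound improves by the factor 1 - N^-m;
   otherwise any two points of A in Q are joined by a chain in A of about N steps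
   of length about r / N, so that f(A `&` p^-1 Q) has diameter
   O(N (r / N)^m) = O(r^m / N). Letting N grow, K = 0.
   Where D^2 f = 0, the cubic lower bounds at x and at y give m = 3, with all
   three coordinates. Where D^2 f <> 0, comparing the second order expansions at
   two points x, y of a piece shows that y - x is almost orthogonal to a nonzero
   row of the Hessian; hence one coordinate of y - x is controlled by the two
   others, and |f x - f y| = O(|x - y|^2) gives m = 2. *)
Require Import Defs.
From mathcomp Require Import all_boot all_order all_algebra.
From mathcomp Require Import all_classical all_reals all_analysis.
From mathcomp Require Import zify ring lra.
From mathcomp Require mpoly.
Import -(notations) mpoly.
Import Order.TTheory GRing.Theory Num.Theory.
Import numFieldNormedType.Exports.
Local Open Scope classical_set_scope.
Local Open Scope ring_scope.

Set Implicit Arguments.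
Unset Strict Implicit.
Unset Printing Implicit Defensive.

(** * Outer measure of unions and of sets of bounded diameter *)

Section OuterMeasure.
Variable R : realType.
Local Notation mu := (@lebesgue_measure R).

Lemma outer_measure_bigcup_seq (T : Type) (nu : {outer_measure set T -> \bar R})
    (I : eqType) (s : seq I) (F : I -> set T) :
  (nu (\bigcup_(i in [set` s]) F i) <= \sum_(i <- s) nu (F i))%E.
Proof.
elim: s => [|i s IH].
  by rewrite big_nil set_nil bigcup_set0 outer_measure0.
rewrite big_cons.
have -> : \bigcup_(j in [set` i :: s]) F j = F i `|` \bigcup_(j in [set` s]) F j.
  apply/seteqP; split=> [y [j /=]|y [Fiy|[j /= js Fjy]]].
  - by rewrite inE => /orP[/eqP->|js] Fjy; [left|right; exists j].
  - by exists i => //=; rewrite inE eqxx.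
  - by exists j => //=; rewrite inE js orbT.
apply: (le_trans (outer_measureU2 _ _ _)).
exact: leeD2l.
Qed.

Lemma outer_measure_countable_bigcup0 (T : Type) (nu : {outer_measure set T -> \bar R})
    (I : countType) (F : I -> set T) :
  (forall i, nu (F i) = 0%E) -> nu (\bigcup_i F i) = 0%E.
Proof.
move=> F0; apply/eqP; rewrite eq_le outer_measure_ge0 andbT.
pose G k := if unpickle k is Some i then F i else set0.
have sub : \bigcup_i F i `<=` \bigcup_k G k.
  by move=> y [i _ Fiy]; exists (pickle i) => //; rewrite /G pickleK.
apply: (le_trans (le_outer_measure nu _ _ sub)).
apply: (le_trans (outer_measure_sigma_subadditive nu G)).
rewrite eseries0 // => k _ _.
by rewrite /G; case: unpickle => [i|]; rewrite ?F0 ?outer_measure0.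
Qed.

(** Any point [s] of [S] yields the cover [[s - D, s + D]]; the factor 2 is harmless in what
    follows. *)
Lemma lebesgue_measure_le_diam (S : set R) (D : R) : 0 <= D ->
  (forall x y, S x -> S y -> `|x - y| <= D) -> (mu S <= (2 * D)%:E)%E.
Proof.
move=> D0 hS; have [->|/set0P[s Ss]] := eqVneq S set0.
  by rewrite measure0 lee_fin mulr_ge0.
have sub : S `<=` [set` `[s - D, s + D]].
  move=> y Sy /=; have := hS _ _ Ss Sy.
  by rewrite in_itv /= ler_distlC.
apply: (@le_trans _ _ (mu [set` `[s - D, s + D]])).
  exact: (le_outer_measure mu _ _ sub).
rewrite lebesgue_measure_itv /= lte_fin; case: ifP => _.
  by rewrite -EFinD lee_fin; lra.
by rewrite lee_fin mulr_ge0.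
Qed.
End OuterMeasure.

(** * Null images under a Hölder condition of exponent [m > 1] in [m] coordinates *)

Section HolderImages.
Variables (R : realType) (m : nat) (T : Type) (p : T -> 'I_m -> R) (F : T -> R).
Variables (A : set T) (C : R).
Hypothesis m_gt1 : (1 < m)%N.
Hypothesis C_ge0 : 0 <= C.
Hypothesis holderF : forall x y (d : R), A x -> A y ->
  (forall i, `|p x i - p y i| <= d) -> `|F x - F y| <= C * d ^+ m.
Local Notation mu := (@lebesgue_measure R).

Let box (a : 'I_m -> R) (r : R) : set T :=
  [set x | forall i, a i <= p x i < a i + r].

Lemma holder_chain (z : nat -> T) (d : R) n : (forall k, A (z k)) ->
  (forall k i, (k < n)%N -> `|p (z k) i - p (z k.+1) i| <= d) ->
  `|F (z 0%N) - F (z n)| <= n%:R * (C * d ^+ m).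
Proof.
move=> Az; elim: n => [|n IH] zd; first by rewrite subrr normr0 mul0r.
apply: (le_trans (ler_distD (F (z n)) _ _)).
rewrite -natr1 mulrDl mul1r lerD //.
  by apply: IH => k i kn; apply: zd; rewrite ltnS ltnW.
by apply: holderF => // i; exact: zd.
Qed.

(* The chain follows the segment from p x to p y in N steps. *)
Lemma holder_dense_box (a : 'I_m -> R) (r : R) (N : nat) : 0 < r -> (0 < N)%N ->
  (forall u : 'I_m -> R, (forall i, a i <= u i < a i + r) ->
    exists2 z, A z & forall i, `|p z i - u i| <= r / N%:R) ->
  forall x y, A x -> A y -> box a r x -> box a r y ->
  `|F x - F y| <= 3 ^+ m.+1 * C * r ^+ m / N%:R.
Proof.
move=> r0 N0 dense x y Ax Ay bx by_.
have N0' : 0 < N%:R :> R by rewrite ltr0n.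
(* [minn] keeps [t k] in [0, 1] for every natural [k], so that the points [z k] can be chosen for
   all [k] at once. *)
pose t (k : nat) : R := (minn k N)%:R / N%:R.
pose u k i := p x i + t k * (p y i - p x i).
have t01 k : 0 <= t k <= 1.
  by rewrite /t divr_ge0 //= ler_pdivrMr // mul1r ler_nat geq_minr.
have ubox k i : a i <= u k i < a i + r.
  have /andP[t0 t1] := t01 k.
  have /andP[x1 x2] := bx i; have /andP[y1 y2] := by_ i.
  have -> : u k i = (1 - t k) * p x i + t k * p y i by rewrite /u; ring.
  apply/andP; split; first by nra.
  have : 0 <= (1 - t k) * (a i + r - p x i) by apply: mulr_ge0; lra.
  (* The box is open above: strictness comes from [p x] if [t k = 0] and from [p y] otherwise. *)
  move: t0; rewrite le_eqVlt => /orP[/eqP<-|t0]; first by lra.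
  have : 0 < t k * (a i + r - p y i) by apply: mulr_gt0; lra.
  lra.
have /choice[z hz] : forall k, exists z, A z /\ forall i, `|p z i - u k i| <= r / N%:R.
  by move=> k; have [z ? ?] := dense (u k) (ubox k); exists z.
(* The chain is x, z 0, ..., z N, y, which makes [N + 2] steps. *)
pose w k := if k is k'.+1 then (if (k' <= N)%N then z k' else y) else x.
have Aw k : A (w k).
  by case: k => //= k; case: ifP => // _; have [] := hz k.
have rN : 0 <= r / N%:R by rewrite divr_ge0 // ltW.
(* At most two approximation errors and one step of the segment, each bounded by [r / N]. *)
have wd k i : (k < N.+2)%N -> `|p (w k) i - p (w k.+1) i| <= 3 * (r / N%:R).
  case: k => [_|k] /=.
    have [_ /(_ i)] := hz 0%N.
    rewrite /u /t min0n mul0r mul0r addr0 distrC => h; lra.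
  rewrite !ltnS => kN; rewrite kN; case: ifP => kN'.
    have [_ /(_ i) h1] := hz k; have [_ /(_ i) h2] := hz k.+1.
    have h3 : `|u k i - u k.+1 i| <= r / N%:R.
      have -> : u k i - u k.+1 i = (p x i - p y i) / N%:R.
        rewrite /u /t (minn_idPl kN) (minn_idPl kN') -natr1.
        by field; rewrite gt_eqF.
      rewrite normrM normfV (gtr0_norm N0') ler_pM2r ?invr_gt0 //.
      have /andP[x1 x2] := bx i; have /andP[y1 y2] := by_ i.
      by rewrite ler_norml; apply/andP; split; lra.
    rewrite ler_norml; move: h1 h2 h3; rewrite !ler_norml.
    move=> /andP[? ?] /andP[? ?] /andP[? ?]; apply/andP; split; lra.
  have kE : k = N by apply/eqP; rewrite eqn_leq kN leqNgt kN'.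
  have [_ /(_ i)] := hz k.
  rewrite /u /t kE minnn divff ?gt_eqF // mul1r => h.
  have -> : p (z N) i - p y i = p (z N) i - (p x i + (p y i - p x i)) by ring.
  lra.
have := holder_chain Aw wd; rewrite /= ltnn => /le_trans; apply.
(* There are [N + 2 <= 3 N] steps, and [N^2 <= N^m] because [m >= 2]: a factor [1 / N] remains. *)
have -> : 3 ^+ m.+1 * C * r ^+ m / N%:R = 3 * N%:R * (C * (3 ^+ m * r ^+ m / N%:R ^+ 2)).
  by rewrite exprS; field; rewrite gt_eqF.
apply: ler_pM => //.
- by rewrite mulr_ge0 // exprn_ge0 // mulr_ge0.
- by rewrite -natrM ler_nat; lia.
rewrite ler_wpM2l // !exprMn exprVn -mulrA ler_wpM2l ?exprn_ge0 //.
rewrite ler_wpM2l ?exprn_ge0 ?(ltW r0) // lef_pV2 ?posrE ?exprn_gt0 //.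
by rewrite ler_weXn2l ?ler1n.
Qed.

(** [K] is uniform in position and scale, so a bound for cubes applies again to their subcubes. *)
Let box_bound (K : R) := forall a (r : R), 0 < r ->
  (mu (F @` (A `&` box a r)) <= (K * r ^+ m)%:E)%E.

Lemma box_bound_holder : box_bound (2 * C).
Proof.
move=> a r r0; rewrite -mulrA; apply: lebesgue_measure_le_diam.
  by rewrite mulr_ge0 // exprn_ge0 // ltW.
move=> _ _ [x [Ax bx] <-] [y [Ay by_] <-]; apply: holderF => // i.
have /andP[? ?] := bx i; have /andP[? ?] := by_ i.
by rewrite ler_norml; apply/andP; split; lra.
Qed.

Let subbox (a : 'I_m -> R) (r : R) (N : nat) (k : {ffun 'I_m -> 'I_N}) : set T :=
  box (fun i => a i + r * (k i)%:R / N%:R) (r / N%:R).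

Lemma subbox_cover (a : 'I_m -> R) (r : R) (N : nat) (u : 'I_m -> R) :
  0 < r -> (0 < N)%N -> (forall i, a i <= u i < a i + r) ->
  exists k : {ffun 'I_m -> 'I_N}, forall i,
    a i + r * (k i)%:R / N%:R <= u i < a i + r * (k i)%:R / N%:R + r / N%:R.
Proof.
case: N => // N r0 _ hu.
have N0 : 0 < N.+1%:R :> R by rewrite ltr0n.
pose v i := (u i - a i) * N.+1%:R / r.
have v0 i : 0 <= v i.
  have /andP[? ?] := hu i.
  by rewrite /v divr_ge0 ?mulr_ge0 ?subr_ge0 // ltW.
(* The strict bound [u i < a i + r] is what makes the integer part of [v i] a legal index. *)
have vN i : (Num.truncn (v i) < N.+1)%N.
  rewrite truncn_lt_nat // /v ltr_pdivrMr // mulrC ltr_pM2l //.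
  by have /andP[? ?] := hu i; lra.
exists [ffun i => Ordinal (vN i)] => i; rewrite ffunE /=.
have /andP[h1 h2] := truncn_itv (v0 i).
have uE : u i = a i + r * v i / N.+1%:R.
  by rewrite /v; field; rewrite !gt_eqF.
rewrite [X in _ <= X < _]uE lerD2l -!addrA ltrD2l -mulrDl.
rewrite ler_pM2r ?invr_gt0 // ltr_pM2r ?invr_gt0 // ler_pM2l // h1 /=.
by rewrite -[X in _ + X]mulr1 -mulrDr ltr_pM2l // natr1.
Qed.

(** The last hypothesis ensures that, when all subcubes meet [A], the diameter estimate is already
    below the improved bound. *)
Lemma box_bound_improve (K : R) (N : nat) : 0 <= K -> (0 < N)%N -> box_bound K ->
  2 * (3 ^+ m.+1 * C / N%:R) <= K * (1 - N%:R ^- m) ->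
  box_bound (K * (1 - N%:R ^- m)).
Proof.
move=> K0 N0 bK hK a r r0.
have N0' : 0 < N%:R :> R by rewrite ltr0n.
have [[k0 Ak0]|hit] := pselect (exists k0, A `&` @subbox a r N k0 = set0).
  pose s := enum (predC1 k0).
  have sub : F @` (A `&` box a r) `<=`
      \bigcup_(k in [set` s]) (F @` (A `&` @subbox a r N k)).
    move=> _ [x [Ax bx] <-].
    have [k hk] := subbox_cover r0 N0 bx.
    exists k; last by exists x.
    rewrite /= mem_enum inE; apply/eqP => kk0.
    have : (A `&` @subbox a r N k0) x by split; [|rewrite -kk0; exact: hk].
    by rewrite Ak0.
  apply: (@le_trans _ _ (mu (\bigcup_(k in [set` s]) (F @` (A `&` @subbox a r N k))))).
    exact: (le_outer_measure mu _ _ sub).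
  apply: (le_trans (outer_measure_bigcup_seq mu _ _)).
  apply: (@le_trans _ _ (\sum_(k <- s) (K * (r / N%:R) ^+ m)%:E)%E).
    by apply: lee_sum => k _; apply: bK; rewrite divr_gt0.
  (* The [N^m - 1] remaining subcubes contribute [(N^m - 1) K (r / N)^m = K (1 - N^-m) r^m]. *)
  rewrite sumEFin lee_fin big_const_seq iter_addr_0 count_predT -cardE.
  rewrite cardC1 card_ffun !card_ord.
  rewrite -subn1 mulrnBr ?expn_gt0 ?N0 // mulr1n -[X in X - _]mulr_natr natrX.
  rewrite exprMn exprVn le_eqVlt; apply/orP; left; apply/eqP; field.
  by rewrite expf_neq0 ?gt_eqF.
(* Every point of the cube now shares its subcube of side [r / N] with a point of [A]. *)
apply: (@le_trans _ _ (2 * (3 ^+ m.+1 * C * r ^+ m / N%:R))%:E).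
  apply: lebesgue_measure_le_diam.
    by rewrite !mulr_ge0 ?invr_ge0 ?exprn_ge0 // ltW.
  move=> _ _ [x [Ax bx] <-] [y [Ay by_] <-].
  apply: (holder_dense_box r0 N0 _ Ax Ay bx by_) => u hu.
  have [k hk] := subbox_cover r0 N0 hu.
  have /set0P[z [Az bz]] : A `&` @subbox a r N k != set0.
    by apply/eqP => h; apply: hit; exists k.
  exists z => // i; have /andP[? ?] := hk i; have /andP[? ?] := bz i.
  by rewrite ler_norml; apply/andP; split; lra.
rewrite lee_fin [leLHS](_ : _ = 2 * (3 ^+ m.+1 * C / N%:R) * r ^+ m); last by ring.
by rewrite ler_wpM2r // exprn_ge0 // ltW.
Qed.

(** The infimum of the admissible constants is itself admissible; were it positive, the improvement
    step would produce a smaller one. *)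
Lemma holder_image_box_null (a : 'I_m -> R) (r : R) : 0 < r ->
  mu (F @` (A `&` box a r)) = 0%E.
Proof.
move=> r0.
pose B := [set K | 0 <= K /\ box_bound K].
have B0 : B !=set0.
  by exists (2 * C); split; [rewrite mulr_ge0|exact: box_bound_holder].
have lbB : has_lbound B by exists 0 => K [].
have K0 : 0 <= inf B by apply: lb_le_inf => // K [].
have bK : box_bound (inf B).
  move=> b s s0; have sm : 0 < s ^+ m by rewrite exprn_gt0.
  have fin : mu (F @` (A `&` box b s)) \is a fin_num.
    rewrite ge0_fin_numE; last exact: outer_measure_ge0.
    by apply: le_lt_trans (box_bound_holder b s0) _; rewrite ltry.
  rewrite -(fineK fin) lee_fin -ler_pdivrMr //.
  apply: lb_le_inf => // K [_ /(_ b s s0)].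
  by rewrite -{1}(fineK fin) lee_fin ler_pdivrMr.
suff K_le0 : inf B <= 0.
  apply/eqP; rewrite eq_le; apply/andP; split; last exact: outer_measure_ge0.
  apply: (le_trans (bK a r r0)); rewrite lee_fin.
  by rewrite mulr_le0_ge0 // exprn_ge0 // ltW.
rewrite leNgt; apply/negP => Kpos.
pose E := 2 * (3 ^+ m.+1 * C).
have E0 : 0 <= E by rewrite !mulr_ge0 ?exprn_ge0.
(* [N >= 2] gives [N^-m <= 1/2], and [N >= 2 E / inf B] gives [E / N <= inf B / 2]. *)
pose N := (Num.truncn (2 * E / inf B)).+2.
have N0' : 0 < N%:R :> R by rewrite ltr0n.
have Nm : 2 <= N%:R ^+ m :> R.
  by rewrite -natrX ler_nat (leq_trans (_ : 2 <= N)%N) // -{1}(expn1 N) leq_exp2l // ltnW.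
have Nm2 : N%:R ^- m <= 2^-1 :> R.
  by rewrite lef_pV2 // posrE ?exprn_gt0.
have EN : E / N%:R <= inf B / 2.
  rewrite ler_pdivrMr //.
  have : 2 * E / inf B <= N%:R.
    by apply/ltW/(lt_le_trans (truncnS_gt _)); rewrite ler_nat.
  by rewrite ler_pdivrMr // => h; lra.
have hK : 2 * (3 ^+ m.+1 * C / N%:R) <= inf B * (1 - N%:R ^- m).
  rewrite [leLHS](_ : _ = E / N%:R); last by rewrite /E !mulrA.
  apply: le_trans EN _; rewrite ler_pM2l //; lra.
have := @box_bound_improve _ N K0 isT bK hK.
have Vm : 0 < N%:R ^- m :> R by rewrite invr_gt0 exprn_gt0.
move=> bK'; have : inf B <= inf B * (1 - N%:R ^- m).
  apply: ge_inf => //; split => //; rewrite mulr_ge0 //; lra.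
rewrite -{1}[inf B]mulr1 ler_pM2l //; lra.
Qed.
End HolderImages.

(** * Norms on R^3 and bounds for homogeneous polynomials *)

Section HomogeneousPolynomials.
Variable R : realType.
Implicit Types (P : poly3 R) (h : 'rV[R]_3) (M : 'M[R]_3).

Lemma coord_le_norm n (h : 'rV[R]_n) i : `|h 0 i| <= `|h|.
Proof.
rewrite [leRHS]mx_normrE.
exact: (le_bigmax 0 (fun ij : 'I_1 * 'I_n => `|h ij.1 ij.2|) (0, i)).
Qed.

Lemma norm_le_coord n (h : 'rV[R]_n) (e : R) : 0 <= e ->
  (forall i, `|h 0 i| <= e) -> `|h| <= e.
Proof.
move=> e0 he; rewrite [leLHS]mx_normrE; apply: bigmax_le => // -[k i] _ /=.
by rewrite ord1.
Qed.

Lemma norm_le_enorm h : `|h| <= enorm h.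
Proof.
apply: norm_le_coord => [|i]; first exact: sqrtr_ge0.
rewrite -sqrtr_sqr ler_wsqrtr // (bigD1 i) //= lerDl.
by apply: sumr_ge0 => j _; exact: sqr_ge0.
Qed.

(** The sharp constant is the square root of 3; 2 keeps later constants rational. *)
Lemma enorm_le_norm h : enorm h <= 2 * `|h|.
Proof.
rewrite -(ger0_norm (_ : 0 <= 2 * `|h|)) ?mulr_ge0 // -sqrtr_sqr ler_wsqrtr //.
have hi i : h 0 i ^+ 2 <= `|h| ^+ 2.
  by rewrite -(real_normK (num_real (h 0 i))) lerXn2r ?nnegrE // coord_le_norm.
rewrite !big_ord_recl big_ord0 exprMn.
have := hi ord0; have := hi (lift ord0 ord0); have := hi (lift ord0 (lift ord0 ord0)).
have := sqr_ge0 `|h|; lra.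
Qed.

Lemma homogeneous_mdeg k P m : homogeneous k P -> m \in msupp P -> mdeg m = k.
Proof. by move=> /dhomogP hP /hP. Qed.

Lemma evalp_scale k P (t : R) h : homogeneous k P ->
  evalp P (t *: h) = t ^+ k * evalp P h.
Proof.
move=> hP; rewrite /evalp !mevalE mulr_sumr.
apply: eq_big_seq => m mP.
under eq_bigr => i _ do rewrite mxE exprMn.
rewrite big_split /= prodrXr -mdegE (homogeneous_mdeg hP mP).
by rewrite mulrCA.
Qed.

Lemma evalp_le k P : homogeneous k P ->
  exists2 C : R, 0 <= C & forall h, `|evalp P h| <= C * `|h| ^+ k.
Proof.
move=> hP; exists (\sum_(m <- msupp P) `|mcoeff m P|) => [|h].
  by apply: sumr_ge0.
rewrite /evalp mevalE mulr_suml (le_trans (ler_norm_sum _ _ _)) //.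
rewrite big_seq [leRHS]big_seq; apply: ler_sum => m mP.
rewrite normrM ler_wpM2l // normr_prod -(homogeneous_mdeg hP mP) mdegE -prodrXr.
apply: ler_prod => i _.
by rewrite normr_ge0 normrX lerXn2r ?nnegrE // coord_le_norm.
Qed.

Definition quad M h : R := \sum_i \sum_j M i j * h 0 i * h 0 j.

(** A monomial of degree 2 is a product of two coordinates, so each term is given by a matrix with
    one entry. The resulting [M] need not be symmetric. *)
Lemma evalp_quad P : homogeneous 2 P -> exists M, forall h, evalp P h = quad M h.
Proof.
move=> hP.
have mon m : mdeg m = 2%N ->
    exists i j : 'I_3, forall h, \prod_k h 0 k ^+ m k = h 0 i * h 0 j.
  move=> m2; have [i mi] : exists i, m i != 0%N.
    apply/existsP; rewrite -negb_forall; apply/negP => /forallP m0.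
    move: m2; rewrite mdegE big1 // => i _; exact/eqP.
  have mK : mnm_add (mnm_sub m (mnm1 i)) (mnm1 i) = m.
    by apply: submK; apply/mnm_lepP => k; rewrite mnm1E; case: eqP => // <-; lia.
  have /mdeg1P[j /eqP mj] : mdeg (mnm_sub m (mnm1 i)) == 1%N.
    by move: m2; rewrite -{1}mK mdegD mdeg1 addn1 => -[->].
  exists j, i => h.
  rewrite -(mevalX (fun k => h 0 k)) -mK mj mpolyXD rmorphM /=.
  by rewrite !mevalXU.
have [E hE] : exists E : multinom 3 -> 'M[R]_3, forall m, m \in msupp P ->
    forall h, mcoeff m P * \prod_k h 0 k ^+ m k = quad (E m) h.
  (* The support condition moves under the existential, with default matrix 0, so that choice
     applies to all [m]. *)
  suff /choice[E hE] : forall m, exists M, m \in msupp P ->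
      forall h, mcoeff m P * \prod_k h 0 k ^+ m k = quad M h by exists E.
  move=> m; have [mP|_] := boolP (m \in msupp P); last by exists 0.
  have [i [j mij]] := mon m (homogeneous_mdeg hP mP).
  exists (mcoeff m P *: delta_mx i j) => _ h.
  rewrite mij /quad (bigD1 i) //= (bigD1 j) //= !mxE !eqxx mulr1 mulrA.
  rewrite big1 ?addr0 => [|l /negPf lj]; last by rewrite !mxE lj andbF mulr0 !mul0r.
  rewrite big1 ?addr0 // => k /negPf ki.
  by rewrite big1 // => l _; rewrite !mxE ki mulr0 !mul0r.
exists (\sum_(m <- msupp P) E m) => h.
rewrite /evalp mevalE (eq_big_seq _ (fun m mP => hE m mP h)).
rewrite /quad exchange_big; apply: eq_bigr => i _.
rewrite exchange_big; apply: eq_bigr => j _.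
by rewrite summxE -!mulr_suml.
Qed.
End HomogeneousPolynomials.

(** * The flat and curved pieces and their null images *)

Section Pieces.
Variable R : realType.
Local Notation mu := (@lebesgue_measure R).

(** The bound holds only at distance at most [e], so space is cut into countably many cells of side
    [e], on each of which it holds throughout. *)
Lemma holder_image_null (n m : nat) (s : 'I_m -> 'I_n) (F : 'rV[R]_n -> R)
    (A : set 'rV[R]_n) (C e : R) :
  (1 < m)%N -> 0 <= C -> 0 < e ->
  (forall x y (d : R), A x -> A y -> `|x - y| <= e ->
    (forall i, `|x 0 (s i) - y 0 (s i)| <= d) -> `|F x - F y| <= C * d ^+ m) ->
  mu (F @` A) = 0%E.
Proof.
move=> m1 C0 e0 hF.
pose cell (g : {ffun 'I_n -> int}) :=
  [set x : 'rV[R]_n | forall i, (g i)%:~R * e <= x 0 i < (g i)%:~R * e + e].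
pose G g := F @` (A `&` cell g).
have G0 g : mu (G g) = 0%E.
  pose p (x : 'rV[R]_n) i := x 0 (s i).
  have hG x y (d : R) : (A `&` cell g) x -> (A `&` cell g) y ->
      (forall i, `|p x i - p y i| <= d) -> `|F x - F y| <= C * d ^+ m.
    move=> [Ax gx] [Ay gy]; apply: hF => //.
    apply: norm_le_coord; first exact: ltW.
    move=> i; rewrite !mxE.
    have /andP[? ?] := gx i; have /andP[? ?] := gy i.
    by rewrite ler_norml; apply/andP; split; lra.
  rewrite /G -(holder_image_box_null m1 C0 hG (fun i => (g (s i))%:~R * e) e0).
  (* A cell lies over the box of the selected coordinates, so intersecting with that box changes
     nothing. *)
  congr (mu (F @` _)); apply/seteqP; split=> [x [Ax gx]|x [//]].
  by split=> // i; exact: gx.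
have sub : F @` A `<=` \bigcup_g G g.
  move=> _ [x Ax <-].
  exists [ffun i => Num.floor (x 0 i / e)] => //; exists x => //; split=> // i.
  rewrite ffunE -ler_pdivlMr // floor_le_tmp /=.
  rewrite -[X in _ + X]mul1r -mulrDl -ltr_pdivrMr //.
  by have /andP[] := floor_itv (x 0 i / e); rewrite intrD.
apply/eqP; rewrite eq_le; apply/andP; split; last exact: outer_measure_ge0.
rewrite -(outer_measure_countable_bigcup0 (nu := mu) G0).
exact: (le_outer_measure mu _ _ sub).
Qed.

Variable f : 'rV[R]_3 -> R.

(** One integer controls both the constant and the radius, so the pieces form a sequence. *)
Definition flat (n : nat) : set 'rV[R]_3 :=
  [set x | forall h, `|h| <= n.+1%:R^-1 -> - (n%:R * `|h| ^+ 3) <= f (x + h) - f x].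

(** The lower bound at [x] towards [y] and the one at [y] towards [x] together bound
    [|f x - f y|]. *)
Lemma flat_image_null n : mu (f @` flat n) = 0%E.
Proof.
apply: (@holder_image_null 3 3 id f (flat n) n%:R n.+1%:R^-1) => // x y d fx fy xy hd.
have d0 : 0 <= d by exact: le_trans (normr_ge0 _) (hd ord0).
have xyd : `|x - y| <= d by apply: norm_le_coord => // i; rewrite !mxE hd.
have hn : n%:R * `|x - y| ^+ 3 <= n%:R * d ^+ 3.
  by rewrite ler_wpM2l // lerXn2r // nnegrE.
have := fy (x - y) xy; rewrite [y + (x - y)]addrC subrK => h1.
have := fx (y - x); rewrite -[`|y - x|]normrN opprB => /(_ xy).
rewrite [x + (y - x)]addrC subrK => h2.
by rewrite ler_norml; apply/andP; split; lra.
Qed.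

(* Twice the (l, i) entry of the Hessian of quad M. *)
Definition hess2 (M : 'M[R]_3) (i l : 'I_3) : R := 2 * (M l i + M i l).

Lemma quadN (M : 'M[R]_3) h : quad M (- h) = quad M h.
Proof.
by apply: eq_bigr => i _; apply: eq_bigr => j _; rewrite !mxE mulrN mulrN mulNr opprK.
Qed.

(** The parts even in [t] cancel and the odd part doubles, whence the factor 2 in [hess2]. *)
Lemma quad_diff (M : 'M[R]_3) (h : 'rV[R]_3) (t : R) i :
  quad M (h + t *: delta_mx 0 i) - quad M (h - t *: delta_mx 0 i) =
  t * \sum_l hess2 M i l * h 0 l.
Proof.
have delta (a : 'I_3 -> R) : \sum_l (l == i)%:R * a l = a i.
  rewrite (bigD1 i) //= eqxx mul1r big1 ?addr0 // => l /negPf ->.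
  by rewrite mul0r.
transitivity (2 * t * (\sum_k \sum_l (l == i)%:R * (M k l * h 0 k)
                       + \sum_k (k == i)%:R * \sum_l M k l * h 0 l)).
  rewrite /quad -sumrB -big_split mulr_sumr; apply: eq_bigr => k _ /=.
  rewrite mulr_sumr -big_split mulr_sumr -sumrB; apply: eq_bigr => l _ /=.
  by rewrite !mxE eqxx /=; ring.
rewrite delta (eq_bigr _ (fun k _ => delta (fun l => M k l * h 0 k))) -big_split.
rewrite !mulr_sumr; apply: eq_bigr => l _; rewrite /hess2 /=; ring.
Qed.

(* The accuracy 1 / (k + 1) of the expansion has to be small against the Hessian,
   independently of the radius 2 / (n + 1) on which it holds. *)
Definition curved (k n : nat) (i j : 'I_3) : set 'rV[R]_3 :=
  [set x | exists M : 'M[R]_3,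
    [/\ forall l, `|hess2 M i l| <= `|hess2 M i j|,
        40 / k.+1%:R <= `|hess2 M i j|,
        forall h, `|quad M h| <= n%:R * `|h| ^+ 2 &
        forall h, `|h| <= 2 / n.+1%:R ->
          `|f (x + h) - f x - quad M h| <= `|h| ^+ 2 / k.+1%:R]].

(** Row [i] of the Hessian at [x] is almost orthogonal to [y - x] and has its largest entry at [j],
    so coordinate [j] is controlled by the other two. *)
Lemma curved_cone k n i j x y : curved k n i j x -> curved k n i j y ->
  `|x - y| <= n.+1%:R^-1 ->
  forall u, (forall l, `|x 0 (lift j l) - y 0 (lift j l)| <= u) -> `|x - y| <= 3 * u.
Proof.
move=> [M [gl gj _ hM]] [M' [_ _ _ hM']] xy u hu.
have N0 : 0 < n.+1%:R :> R by rewrite ltr0n.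
have k0 : 0 < k.+1%:R :> R by rewrite ltr0n.
have [t tE] : exists t : R, t = `|x - y| by eexists.
rewrite -tE in xy *; pose d := y - x.
have u0 : 0 <= u := le_trans (normr_ge0 _) (hu ord0).
have [t0|t_neq0] := eqVneq t 0; first by rewrite t0 mulr_ge0.
have t_ge0 : 0 <= t by rewrite tE.
have t_gt0 : 0 < t by rewrite lt_neqAle eq_sym t_neq0.
have dt : `|d| = t by rewrite /d -normrN opprB tE.
(* The expansions at x and at y are compared at the points y + s and y - s; taking
   the difference cancels the even form quad M'. *)
pose s : 'rV[R]_3 := t *: delta_mx 0 i.
have st : `|s| <= t.
  apply: norm_le_coord => // l; rewrite !mxE eqxx normrM ger0_norm //.
  by rewrite ler_piMr // normr_nat lern1 leq_b1.
have ds1 : `|d + s| <= 2 * t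
  by apply: le_trans (ler_normD _ _) _; rewrite mulr_natl mulr2n lerD ?dt.
have ds2 : `|d - s| <= 2 * t
  by apply: le_trans (ler_normB _ _) _; rewrite mulr_natl mulr2n lerD ?dt.
(* [d + s] and [d - s] may have norm [2 t]; this is why the expansions are required up to radius
   [2 / (n + 1)]. *)
have tN : 2 * t <= 2 / n.+1%:R by rewrite ler_pM2l.
have tN' : t <= 2 / n.+1%:R by apply: le_trans tN; rewrite mulr_natl mulr2n lerDl.
have hs : `|- s| <= t by rewrite normrN.
have bound (h : 'rV[R]_3) (c : R) : 0 <= c -> `|h| <= c -> `|h| ^+ 2 / k.+1%:R <= c ^+ 2 / k.+1%:R.
  by move=> c0 hc; rewrite ler_pM2r ?invr_gt0 // lerXn2r // nnegrE.
have e1 : x + (d + s) = y + s by rewrite addrA [x + d]addrC subrK.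
have e2 : x + (d - s) = y - s by rewrite addrA [x + d]addrC subrK.
have t2 : 0 <= 2 * t by lra.
have h1 := le_trans (hM _ (le_trans ds1 tN)) (bound _ _ t2 ds1).
have h2 := le_trans (hM _ (le_trans ds2 tN)) (bound _ _ t2 ds2).
have h3 := le_trans (hM' _ (le_trans st tN')) (bound _ _ t_ge0 st).
have h4 := le_trans (hM' _ (le_trans hs tN')) (bound _ _ t_ge0 hs).
rewrite e1 in h1; rewrite e2 in h2; rewrite quadN in h4.
(* The four errors add up to [(4 + 4 + 1 + 1) t^2 / (k + 1)]; a factor [t] is then divided out. *)
have h5 : `|\sum_l hess2 M i l * d 0 l| <= 10 * t / k.+1%:R.
  rewrite -(ler_pM2l t_gt0) -{1}(ger0_norm t_ge0) -normrM -quad_diff -/s.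
  rewrite [leRHS](_ : _ = (2 * t) ^+ 2 / k.+1%:R + (2 * t) ^+ 2 / k.+1%:R
    + t ^+ 2 / k.+1%:R + t ^+ 2 / k.+1%:R); last by field; rewrite gt_eqF.
  move: h1 h2 h3 h4; rewrite !ler_norml.
  move: (f (y + s)) (f (y - s)) (quad M (d + s)) (quad M (d - s)) (quad M' s) => a1 a2 a3 a4 a5.
  move: ((2 * t) ^+ 2 / k.+1%:R) (t ^+ 2 / k.+1%:R) => A B.
  move=> /andP[? ?] /andP[? ?] /andP[? ?] /andP[? ?].
  by apply/andP; split; lra.
have gj0 : 0 < `|hess2 M i j| by apply: lt_le_trans gj; rewrite divr_gt0.
have hdu l : `|d 0 (lift j l)| <= u.
  by apply: le_trans (hu l); rewrite !mxE distrC.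
(* After division by the largest entry, the two other coordinates cost [u] each, and the constant 40
   turns the error into [t / 4]. *)
have dj : `|d 0 j| <= 2 * u + t / 4.
  rewrite -(ler_pM2l gj0) -normrM.
  move: h5; rewrite (bigD1_ord j) //= => h5.
  have hsum : `|\sum_(l < 2) hess2 M i (lift j l) * d 0 (lift j l)| <= `|hess2 M i j| * (2 * u).
    apply: le_trans (ler_norm_sum _ _ _) _.
    apply: (@le_trans _ _ (\sum_(l < 2) `|hess2 M i j| * u)).
      by apply: ler_sum => l _; rewrite normrM; apply: ler_pM.
    by rewrite sumr_const card_ord -mulr_natl; lra.
  have h6 : 10 * t / k.+1%:R <= `|hess2 M i j| * (t / 4).
    have -> : 10 * t / k.+1%:R = 40 / k.+1%:R * (t / 4) by field; rewrite gt_eqF.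
    by rewrite ler_wpM2r // divr_ge0.
  move: h5 hsum h6; rewrite mulrDr !ler_norml.
  move: (hess2 M i j * d 0 j) (\sum_(l < 2) _) (10 * t / k.+1%:R) => a b A.
  move: (`|hess2 M i j| * (2 * u)) (`|hess2 M i j| * (t / 4)) => B D.
  move=> /andP[? ?] /andP[? ?] ?.
  by apply/andP; split; lra.
(* The sup norm [t] is bounded through each coordinate; absorbing [t / 4] gives [t <= 8 u / 3]. *)
have td : t <= 2 * u + t / 4.
  rewrite -dt; apply: norm_le_coord; first by rewrite dt; lra.
  move=> l; case: (unliftP j l) => [l' ->|->]; last by rewrite dt.
  by apply: le_trans (hdu l') _; rewrite dt; lra.
lra.
Qed.

(** The expansion at [y] gives [|f x - f y| <= (n + 1) |x - y|^2], and [|x - y| <= 3 d] in terms of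
    the two coordinates other than [j]: hence [m = 2] and the constant [9 (n + 1)]. *)
Lemma curved_image_null k n i j : mu (f @` curved k n i j) = 0%E.
Proof.
have N0 : 0 < n.+1%:R :> R by rewrite ltr0n.
apply: (@holder_image_null 3 2 (lift j) f _ (9 * n.+1%:R) n.+1%:R^-1) => //.
move=> x y d cx cy xy hd.
have d0 : 0 <= d by exact: le_trans (normr_ge0 _) (hd ord0).
have xyd := curved_cone cx cy xy hd.
case: cy => M [_ _ qM hM].
have hxy : `|x - y| <= 2 / n.+1%:R.
  by apply: le_trans xy _; rewrite -{1}[_^-1]mul1r ler_pM2r ?invr_gt0 // ler1n.
have := hM _ hxy; rewrite [y + (x - y)]addrC subrK => h1.
have h2 := qM (x - y).
have xyd2 : `|x - y| ^+ 2 <= (3 * d) ^+ 2.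
  by rewrite lerXn2r // nnegrE // mulr_ge0.
have h3 : `|x - y| ^+ 2 / k.+1%:R <= `|x - y| ^+ 2.
  by rewrite ler_piMr ?sqr_ge0 // invf_le1 // ler1n.
have h4 : `|f x - f y| <= n.+1%:R * `|x - y| ^+ 2.
  rewrite -natr1 mulrDl mul1r; move: (le_trans h1 h3) h2; rewrite !ler_norml.
  move: (quad M (x - y)) (`|x - y| ^+ 2) (n%:R * _) => a b c.
  by move=> /andP[? ?] /andP[? ?]; apply/andP; split; lra.
apply: le_trans h4 _.
rewrite [leRHS](_ : _ = n.+1%:R * (3 * d) ^+ 2); last by ring.
by rewrite ler_wpM2l.
Qed.
End Pieces.

(** * Countable decomposition of the critical set *)

Section Decomposition.
Variables (R : realType) (f : 'rV[R]_3 -> R).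

Lemma dnbhs0_norm (P : 'rV[R]_3 -> Prop) : (\forall h \near (0 : 'rV[R]_3)^', P h) ->
  exists2 e : R, 0 < e & forall h, h != 0 -> `|h| < e -> P h.
Proof.
by rewrite near_withinE => /nbhs_norm0P[e /= e0 he]; exists e => // h h0 /he; apply.
Qed.

Lemma exists_nat_ge (a : R) : exists n, a <= n%:R.
Proof. by exists (Num.truncn a).+1; exact/ltW/truncnS_gt. Qed.

Lemma evalp0 k P : homogeneous k.+1 P -> evalp P (0 : 'rV[R]_3) = 0.
Proof. by move=> hP; have := evalp_scale 0 0 hP; rewrite scale0r expr0n mul0r. Qed.

Lemma taylor2_le x P1 P2 (e : R) : taylor2 f x P1 P2 -> 0 < e ->
  exists2 r : R, 0 < r & forall h, `|h| < r ->
    `|f (x + h) - f x - evalp P1 h - evalp P2 h| <= e * `|h| ^+ 2.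
Proof.
move=> [hP1 hP2 /cvgr0Pnorm_le cvg] e0.
(* The 4 pays for [enorm h ^+ 2 <= 4 * |h| ^+ 2]. *)
have e4 : 0 < e / 4 by rewrite divr_gt0.
have [r r0 hr] := dnbhs0_norm (cvg _ e4).
exists r => // h hlt; have [->|h0] := eqVneq h 0.
  by rewrite addr0 (evalp0 hP1) (evalp0 hP2) subrr !subr0 !normr0 expr0n mulr0.
have en0 : 0 < enorm h by apply: lt_le_trans (norm_le_enorm h); rewrite normr_gt0.
have := hr h h0 hlt; rewrite normrM normfV (gtr0_norm (exprn_gt0 2 en0)).
rewrite ler_pdivrMr ?exprn_gt0 // => /le_trans; apply.
have -> : e * `|h| ^+ 2 = e / 4 * (2 * `|h|) ^+ 2 by field.
rewrite ler_wpM2l ?(ltW e4) // lerXn2r ?nnegrE ?(ltW en0) ?mulr_ge0 //.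
exact: enorm_le_norm.
Qed.

Lemma diff0_le x (e : R) : differentiable f x ->
  'd f x = cst 0 :> ('rV[R]_3 -> R) -> 0 < e ->
  exists2 r : R, 0 < r & forall h, `|h| < r -> `|f (x + h) - f x| <= e * `|h|.
Proof.
move=> df d0 e0.
have /eqaddoP /(_ _ e0) /nbhs_norm0P[r /= r0 hr] := diff_locally df.
exists r => // h /hr; rewrite d0 !fctE /= addr0 [h + x]addrC.
exact.
Qed.

(** Comparing both expansions at [a *: h] bounds [a |P1(h)|] by [o(a)], so letting [a] tend to 0
    identifies [P1] with the zero differential. *)
Lemma taylor2_crit x P1 P2 : taylor2 f x P1 P2 -> differentiable f x ->
  'd f x = cst 0 :> ('rV[R]_3 -> R) -> forall h, evalp P1 h = 0.
Proof.
move=> tf df d0 h; have [hP1 hP2 _] := tf.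
have [->|h0] := eqVneq h 0; first exact: evalp0 hP1.
have hpos : 0 < `|h| by rewrite normr_gt0.
apply/eqP; rewrite -normr_le0; apply/ler_addgt0Pl => e e0; rewrite addr0.
have [C C0 hC] := evalp_le hP2.
pose c := e / (2 * `|h|).
have c0 : 0 < c by rewrite divr_gt0 ?mulr_gt0.
have [r1 r10 h1] := taylor2_le tf c0.
have [r2 r20 h2] := diff0_le df d0 c0.
have cC : 0 < c + C by rewrite ltr_wpDr.
(* [a *: h] lies strictly within both radii, and the quadratic terms total at most [a e / 2]; by the
   choice of [c] the linear term is [a e / 2]. *)
pose a := Num.min (Num.min (r1 / (2 * `|h|)) (r2 / (2 * `|h|)))
  (e / (2 * (c + C) * `|h| ^+ 2)).
have a0 : 0 < a by rewrite !lt_min !divr_gt0 ?mulr_gt0 ?exprn_gt0.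
have [a1 a2 a3] : [/\ a * `|h| < r1, a * `|h| < r2 & (c + C) * a * `|h| ^+ 2 <= e / 2].
  have : a <= a by []; rewrite {2}/a !le_min => /andP[/andP[]].
  rewrite !ler_pdivlMr ?mulr_gt0 ?exprn_gt0 // => b1 b2 b3.
  have ah : 0 < a * `|h| by rewrite mulr_gt0.
  by split; lra.
have nah : `|a *: h| = a * `|h| by rewrite normrZ gtr0_norm.
have k1 := h1 (a *: h); rewrite nah in k1; have {}k1 := k1 a1.
have k2 := h2 (a *: h); rewrite nah in k2; have {}k2 := k2 a2.
have k3 := hC (a *: h); rewrite nah in k3.
have k4 : `|evalp P1 (a *: h)| <= c * (a * `|h|) ^+ 2 + c * (a * `|h|) + C * (a * `|h|) ^+ 2.
  move: k1 k2 k3; rewrite !ler_norml.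
  move: (c * _ ^+ 2) (c * (a * _)) (C * _) => u v w.
  move=> /andP[? ?] /andP[? ?] /andP[? ?].
  by apply/andP; split; lra.
rewrite -(ler_pM2l a0) -{1}(gtr0_norm a0) -normrM -[a * evalp _ _]/(a ^+ 1 * _).
rewrite -(evalp_scale _ _ hP1); apply: le_trans k4 _.
have -> : c * (a * `|h|) = a * (e / 2) by rewrite /c; field; rewrite gt_eqF.
have -> : c * (a * `|h|) ^+ 2 + a * (e / 2) + C * (a * `|h|) ^+ 2 =
  a * (e / 2 + (c + C) * a * `|h| ^+ 2) by ring.
by rewrite ler_pM2l //; lra.
Qed.

Lemma limf_einf_ge0_near (g : 'rV[R]_3 -> R) (e : R) : 0 < e ->
  (0 <= limf_einf (fun h => (g h)%:E) (0%R : 'rV[R]_3)^')%E ->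
  exists2 r : R, 0 < r & forall h, h != 0 -> `|h| < r -> - e <= g h.
Proof.
move=> e0 hg; apply: dnbhs0_norm.
have : (- e%:E < limf_einf (fun h => (g h)%:E) (0%R : 'rV[R]_3)^')%E.
  by apply: lt_le_trans hg; rewrite -EFinN lte_fin oppr_lt0.
(* The lower limit is a supremum of infima over punctured neighbourhoods, one of which already
   exceeds [- e]. *)
rewrite limf_einfE => /ereal_sup_gt[_ [V V0 <-] hV].
apply: filterS V0 => h Vh; rewrite -lee_fin EFinN; apply: ltW (lt_le_trans hV _).
by apply: ereal_inf_lbound; exists h.
Qed.

(** The alternative is whether the largest entry of [hess2 M] in absolute value vanishes. *)
Lemma crit3_flat_or_curved x : crit3 f x ->
  (exists n, flat f n x) \/ (exists k n i j, curved f k n i j x).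
Proof.
move=> [df d0 [Q [hQ [P1 [P2 [tf liminf]]]]]].
have [hP1 hP2 _] := tf.
have P10 := taylor2_crit tf df d0.
have [M hM] := evalp_quad hP2.
have [Cq Cq0 hCq] := evalp_le hP2.
pose w (ij : 'I_3 * 'I_3) : R := `|hess2 M ij.1 ij.2|.
have [[i j] _ wmax] := @arg_maxP _ R _ (ord0, ord0) xpredT w isT.
have [wij0|wij_neq0] := eqVneq (w (i, j)) 0.
  (* Vanishing of [hess2] makes [M] antisymmetric, so [quad M] cancels against its transpose. *)
  have q0 h : quad M h = 0.
    have gr0 a b : hess2 M a b = 0.
      by apply/eqP; rewrite -normr_le0 -wij0; exact: (wmax (a, b)).
    have : quad M h + quad M h = 0.
      rewrite {2}/quad exchange_big -big_split big1 // => a _.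
      rewrite -big_split big1 // => b _ /=.
      have Mab : M a b + M b a = 0 by have := gr0 b a; rewrite /hess2; lra.
      transitivity ((M a b + M b a) * (h 0 a * h 0 b)); first by ring.
      by rewrite Mab mul0r.
    lra.
  left.
  have [CQ CQ0 hCQ] := evalp_le hQ.
  have [r r0 hr] := limf_einf_ge0_near (ltr01 : 0 < 1 :> R) liminf.
  (* [CQ] bounds [Q], [8 = 2^3] converts the Euclidean norm in the lower bound -1 of the quotient,
     and [r^-1] makes the radius [1 / (n + 1)] less than [r]. *)
  have [n hn] := exists_nat_ge (CQ + 8 + r^-1).
  have Vr : 0 < r^-1 by rewrite invr_gt0.
  exists n => h hh; have [->|h0] := eqVneq h 0.
    by rewrite addr0 normr0 subrr expr0n mulr0 oppr0.
  have hlt : `|h| < r.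
    apply: le_lt_trans hh _; rewrite invf_plt ?posrE ?ltr0n // -natr1; lra.
  have en0 : 0 < enorm h by apply: lt_le_trans (norm_le_enorm h); rewrite normr_gt0.
  have := hr h h0 hlt; rewrite d0 /= subr0 hM q0 subr0.
  rewrite ler_pdivlMr ?exprn_gt0 // mulN1r.
  have e3 : enorm h ^+ 3 <= 8 * `|h| ^+ 3.
    have -> : 8 * `|h| ^+ 3 = (2 * `|h|) ^+ 3 by ring.
    rewrite lerXn2r ?nnegrE ?(ltW en0) ?mulr_ge0 //; exact: enorm_le_norm.
  have := hCQ h; rewrite ler_norml => /andP[q1 q2] h1.
  have : (CQ + 8) * `|h| ^+ 3 <= n%:R * `|h| ^+ 3.
    by rewrite ler_wpM2r ?exprn_ge0 //; lra.
  rewrite mulrDl; lra.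
right.
have g0 : 0 < w (i, j) by rewrite lt_neqAle eq_sym wij_neq0 /w normr_ge0.
(* [k] depends on the Hessian alone; the radius [r], and then [n], are chosen after it. *)
have [k hk] := exists_nat_ge (40 / w (i, j)).
have k0 : 0 < k.+1%:R :> R by rewrite ltr0n.
have Vk : 0 < k.+1%:R^-1 :> R by rewrite invr_gt0.
have [r r0 hr] := taylor2_le tf Vk.
(* [Cq] bounds the quadratic form, and [2 / r] gives [2 / (n + 1) < r]. *)
have [n hn] := exists_nat_ge (Cq + 2 / r).
have Vr : 0 < 2 / r by rewrite divr_gt0.
exists k, n, i, j, M; split.
- by move=> l; exact: (wmax (i, l)).
- rewrite ler_pdivrMr // mulrC -ler_pdivrMr //; apply: le_trans hk _.
  by rewrite ler_nat.
- move=> h; rewrite -hM; apply: le_trans (hCq h) _.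
  by rewrite ler_wpM2r ?exprn_ge0 //; lra.
move=> h hh; rewrite [leRHS]mulrC -hM.
have := hr h; rewrite P10 subr0; apply.
apply: le_lt_trans hh _; rewrite ltr_pdivrMr ?ltr0n // mulrC -ltr_pdivrMr // -natr1; lra.
Qed.
End Decomposition.

Theorem theorem1p9 (R : realType) (f : 'rV[R]_3 -> R)
    (hf : lower_semicontinuous (fun x : 'rV[R]_3 => (f x)%:E)) :
  lebesgue_outer (f @` crit3 f) = 0%E.
Proof.
change (lebesgue_measure (f @` crit3 f) = 0%E).
pose nu := @lebesgue_measure R.
have sub : f @` crit3 f `<=` (\bigcup_n f @` flat f n) `|`
    \bigcup_(t : nat * nat * 'I_3 * 'I_3) f @` curved f t.1.1.1 t.1.1.2 t.1.2 t.2.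
  move=> _ [x /crit3_flat_or_curved[[n xn]|[k [n [i [j xc]]]]] <-].
    by left; exists n => //; exists x.
  by right; exists (k, n, i, j) => //; exists x.
apply/eqP; rewrite eq_le; apply/andP; split; last exact: outer_measure_ge0.
apply: le_trans (le_outer_measure nu _ _ sub) _.
apply: le_trans (outer_measureU2 _ _ _) _.
rewrite (outer_measure_countable_bigcup0 (nu := nu) (flat_image_null f)) add0e.
rewrite (outer_measure_countable_bigcup0 (nu := nu)) // => t.
exact: curved_image_null.
Qed.
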